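(* Let $\mathcal{V}$ be a variety of groups and let $\{(G_i,N_i)\}_{i\in I}$ be a direct system of pairs of groups indexed by a directed set $I$. Then $$\mathcal{V}M(\varinjlim G_i,\varinjlim N_i)\cong \varinjlim \mathcal{V}M(G_i,N_i).$$
   Context: A pair of groups $(G,N)$ is a group $G$ with a normal subgroup $N$; a homomorphism of pairs $(G_1,N_1)\to(G_2,N_2)$ is a group homomorphism $G_1\to G_2$ sending $N_1$ into $N_2$. $\mathcal{V}$ is a variety of groups defined by a set of laws $V$, and $V(G)$ denotes the verbal subgroup of $G$ determined by $V$. A free simplicial resolution of a group $G$ is a free simplicial group $K_.$ (each $K_n$ is a free group and the degeneracies send the free basis of $K_n$ into the free basis of $K_{n+1}$), constructed functorially in $G$, with $\pi_0(K_.)\cong G$ and $\pi_m(K_.)=0$ for $m\ge 1$. For a simplicial group $K_.$, $K_./V(K_.)$ is formed dimensionwise. Given a pair $(G,N)$, let $K_.$ and $L_.$ be free simplicial resolutions of $G$ and $G/N$; the natural epimorphism $G\to G/N$ induces an epimorphism of simplicial groups $\alpha:K_.\to L_.$, and hence an epimorphism $\frac{\alpha}{V(\alpha)}:\frac{K_.}{V(K_.)}\to\frac{L_.}{V(L_.)}$. The Baer invariant of the pair $(G,N)$ with respect to $\mathcal{V}$ is $\mathcal{V}M(G,N)=\pi_1\big(\ker\frac{\alpha}{V(\alpha)}\big)$, the kernel being taken dimensionwise. *)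

(* Defs.v *)
From HB Require Import structures.
From mathcomp Require Import all_boot all_order.
From mathcomp Require Import generic_quotient boolp classical_sets.

Set Implicit Arguments.
Unset Strict Implicit.
Unset Printing Implicit Defensive.

Import Order.Theory.

Local Open Scope classical_set_scope.
Local Open Scope quotient_scope.
Local Open Scope group_scope.

Notation "{ 'hom' G -> H }" := (UMagmaMorphism.type G H)
  (at level 0, G at level 98, H at level 99, format "{ 'hom'  G  ->  H }")
  : type_scope.

Section Homomorphisms.
Variables (G H : groupType).

Lemma hom_ext (f g : {hom G -> H}) : f =1 g -> f = g.
Proof.
case: f g => [f cf] [g cg] /= /funext fg; rewrite {}fg in cf *.
congr UMagmaMorphism.Pack.
case: cf cg => [[a] [b]] [[c] [d]].
by rewrite (Prop_irrelevance a c) (Prop_irrelevance b d).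
Qed.

Variables (f : G -> H) (fM : {morph f : x y / x * y}).

Lemma hom_of_1 : f 1 = 1.
Proof. by apply: (mulgI (f 1)); rewrite -fM !mulg1. Qed.

Definition hom_of : {hom G -> H} :=
  HB.pack f (isMultiplicative.Build G H f fM)
    (Multiplicative_isUMagmaMorphism.Build G H f hom_of_1).

End Homomorphisms.

Record subgroup (G : groupType) := Subgroup {
  sg_set :> G -> Prop;
  sg1 : sg_set 1;
  sgM : forall x y, sg_set x -> sg_set y -> sg_set (x * y);
  sgV : forall x, sg_set x -> sg_set x^-1 }.

Record normal_subgroup (G : groupType) := NormalSubgroup {
  ns_sub :> subgroup G;
  nsJ : forall x y, ns_sub x -> ns_sub (x ^ y) }.

Section SubgroupAsGroup.
Variables (G : groupType) (S : subgroup G).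

Record subgrp : Type :=
  SubGrp { subgrp_val : G; subgrp_valP : `[< S subgrp_val >] }.

HB.instance Definition _ := [isSub for subgrp_val].
HB.instance Definition _ := [Choice of subgrp by <:].

Fact subgrp_closed : group_closed (fun x : G => `[< S x >]).
Proof.
split; first by apply/asboolP; exact: sg1.
move=> x y /asboolP Sx /asboolP Sy; apply/asboolP; apply: sgM => //.
exact: sgV.
Qed.

HB.instance Definition _ :=
  SubChoice_isSubGroup.Build G (fun x : G => `[< S x >]) subgrp subgrp_closed.

Lemma subgrpP (x : subgrp) : S (val x).
Proof. exact/asboolP/(valP x). Qed.

Definition to_subgrp (x : G) (Sx : S x) : subgrp := SubGrp (asboolT Sx).

End SubgroupAsGroup.

Section SubMap.
Variables (G H : groupType) (S : subgroup G) (T : subgroup H).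
Variables (f : {hom G -> H}) (fST : forall x, S x -> T (f x)).

Definition sub_fun (x : subgrp S) : subgrp T := to_subgrp (fST (subgrpP x)).

Fact sub_funM : {morph sub_fun : x y / x * y}.
Proof. by move=> x y; apply: val_inj; rewrite /= !gmulfM. Qed.

Definition sub_map : {hom subgrp S -> subgrp T} := hom_of sub_funM.

Lemma val_sub_map x : val (sub_map x) = f (val x).
Proof. by []. Qed.

End SubMap.

Section Quotient.
Variables (G : groupType) (N : normal_subgroup G).

Definition coset_rel (x y : G) : bool := `[< N (x^-1 * y) >].

Fact coset_rel_refl : reflexive coset_rel.
Proof. by move=> x; apply/asboolP; rewrite mulVg; apply: sg1. Qed.

Fact coset_rel_sym : symmetric coset_rel.
Proof.
by move=> x y; apply/asboolP/asboolP => /sgV; rewrite invgM invgK.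
Qed.

Fact coset_rel_trans : transitive coset_rel.
Proof.
move=> y x z /asboolP xy /asboolP yz; apply/asboolP.
by have := sgM xy yz; rewrite -mulgA mulVKg.
Qed.

Canonical coset_equiv :=
  EquivRel coset_rel coset_rel_refl coset_rel_sym coset_rel_trans.

Definition quogrp : Type := {eq_quot coset_equiv}.

HB.instance Definition _ := Choice.on quogrp.
HB.instance Definition _ := EqQuotient.on quogrp.

Definition quo_class (x : G) : quogrp := \pi_quogrp%qT x.

Lemma quo_classE x y : quo_class x = quo_class y <-> N (x^-1 * y).
Proof.
have e : (quo_class x == quo_class y) = coset_rel x y by exact: eqmodE.
split=> [/eqP|Nxy]; first by rewrite e => /asboolP.
by apply/eqP; rewrite e; apply/asboolP.
Qed.

Lemma quo_ind (P : quogrp -> Prop) : (forall x, P (quo_class x)) -> forall c, P c.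
Proof. by move=> Px c; rewrite -[c]reprK; exact: Px. Qed.

Let reprP x : N ((repr (quo_class x))^-1 * x).
Proof. by apply/quo_classE; exact: reprK. Qed.

Definition quo_one : quogrp := quo_class 1.
Definition quo_mul (a b : quogrp) : quogrp := quo_class (repr a * repr b).
Definition quo_inv (a : quogrp) : quogrp := quo_class (repr a)^-1.

Lemma quo_mulE x y : quo_mul (quo_class x) (quo_class y) = quo_class (x * y).
Proof.
apply/quo_classE; move: (reprP x) (reprP y).
set u := repr _; set v := repr _ => Nx Ny.
suff -> : (u * v)^-1 * (x * y) = (u^-1 * x) ^ v * (v^-1 * y).
  by apply: sgM => //; exact: nsJ.
by rewrite /conjg invgM !mulgA mulgK.
Qed.

Lemma quo_invE x : quo_inv (quo_class x) = quo_class x^-1.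
Proof.
apply/quo_classE; move: (reprP x); set u := repr _ => Nx.
suff -> : u^-1^-1 * x^-1 = ((u^-1 * x)^-1) ^ u^-1 by exact/nsJ/sgV.
by rewrite /conjg invgM !invgK !mulgA mulgK.
Qed.

Fact quo_mulA : associative quo_mul.
Proof.
by do 3![elim/quo_ind=> ?]; rewrite !quo_mulE mulgA.
Qed.
Fact quo_mul1 : left_id quo_one quo_mul.
Proof. by elim/quo_ind=> ?; rewrite quo_mulE mul1g. Qed.
Fact quo_1mul : right_id quo_one quo_mul.
Proof. by elim/quo_ind=> ?; rewrite quo_mulE mulg1. Qed.
Fact quo_mulV : left_inverse quo_one quo_inv quo_mul.
Proof. by elim/quo_ind=> ?; rewrite quo_invE quo_mulE mulVg. Qed.
Fact quo_Vmul : right_inverse quo_one quo_inv quo_mul.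
Proof. by elim/quo_ind=> ?; rewrite quo_invE quo_mulE mulgV. Qed.

HB.instance Definition _ :=
  isGroup.Build quogrp quo_mulA quo_mul1 quo_1mul quo_mulV quo_Vmul.

Fact quo_classM : {morph quo_class : x y / x * y}.
Proof. by move=> x y; rewrite -quo_mulE. Qed.

Definition quo_pi : {hom G -> quogrp} := hom_of quo_classM.

Lemma quo_piP (P : quogrp -> Prop) :
  (forall x, P (quo_pi x)) -> forall c, P c.
Proof. exact: quo_ind. Qed.

Lemma quo_pi_eq x y : quo_pi x = quo_pi y <-> N (x^-1 * y).
Proof. exact: quo_classE. Qed.

End Quotient.

Section QuoMap.
Variables (G H : groupType) (N : normal_subgroup G) (M : normal_subgroup H).
Variables (f : {hom G -> H}) (fNM : forall x, N x -> M (f x)).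

Definition quo_fun : quogrp N -> quogrp M :=
  lift_op11 (quogrp N) (quogrp M) f.

Lemma quo_funE x : quo_fun (quo_pi N x) = quo_pi M (f x).
Proof.
rewrite /quo_fun -lock; apply/quo_classE; rewrite -gmulfV -gmulfM; apply: fNM.
by apply/quo_classE; exact: reprK.
Qed.

Fact quo_funM : {morph quo_fun : x y / x * y}.
Proof.
elim/quo_ind=> x; elim/quo_ind=> y.
by rewrite -quo_classM !quo_funE !gmulfM.
Qed.

Definition quo_map : {hom quogrp N -> quogrp M} := hom_of quo_funM.

Lemma quo_mapE x : quo_map (quo_pi N x) = quo_pi M (f x).
Proof. exact: quo_funE. Qed.

End QuoMap.

Section Kernel.
Variables (G H : groupType) (f : {hom G -> H}).

Definition kernel : subgroup G.
Proof.
exists (fun x => f x = 1); first exact: gmulf1.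
  by move=> x y fx fy; rewrite gmulfM fx fy mulg1.
by move=> x fx; rewrite gmulfV fx invg1.
Defined.

End Kernel.

(** A word in the letters [x_0, x_1, ...]: [(i, false)] stands for [x_i] and
    [(i, true)] for its inverse. *)
Definition word := seq (nat * bool).

Definition word_eval (G : groupType) (g : nat -> G) (w : word) : G :=
  \prod_(a <- w) (if a.2 then (g a.1)^-1 else g a.1).

Lemma word_eval_hom (G H : groupType) (f : {hom G -> H}) (g : nat -> G) w :
  f (word_eval g w) = word_eval (f \o g) w.
Proof.
rewrite /word_eval gmulf_prod; apply: eq_bigr => -[i []] _ //=.
exact: gmulfV.
Qed.

Section Verbal.
Variables (V : set word) (G : groupType).

Definition verbal_set (x : G) : Prop :=
  forall S : subgroup G,
    (forall w (g : nat -> G), V w -> S (word_eval g w)) -> S x.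

Definition verbal_subgroup : subgroup G.
Proof.
exists verbal_set.
- by move=> S _; exact: sg1.
- by move=> x y Vx Vy S VS; apply: sgM; [apply: Vx | apply: Vy].
- by move=> x Vx S VS; apply/sgV/Vx.
Defined.

End Verbal.

Section Preimage.
Variables (G H : groupType) (f : {hom G -> H}) (S : subgroup H).

Definition preim_subgroup : subgroup G.
Proof.
exists (fun x => S (f x)).
- by rewrite gmulf1; exact: sg1.
- by move=> x y; rewrite gmulfM; exact: sgM.
- by move=> x; rewrite gmulfV; exact: sgV.
Defined.

End Preimage.

Lemma verbal_hom (V : set word) (G H : groupType) (f : {hom G -> H}) x :
  verbal_subgroup V G x -> verbal_subgroup V H (f x).
Proof.
move=> Vx S VS; apply: (Vx (preim_subgroup f S)) => w g Vw /=.
by rewrite word_eval_hom; exact: VS.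
Qed.

Lemma conjg_morph (G : groupType) (y : G) : {morph (fun x => x ^ y) : a b / a * b}.
Proof. by move=> a b; rewrite conjMg. Qed.

Definition verbal (V : set word) (G : groupType) : normal_subgroup G.
Proof.
exists (verbal_subgroup V G) => x y.
exact: (@verbal_hom V G G (hom_of (conjg_morph y))).
Defined.

(** [i^w] has the value of [i] and [i^s] the value of [i] plus one, both
    in the next larger ordinal. *)
Local Notation "i ^w" := (widen_ord (leqnSn _) i)
  (at level 1, format "i ^w").
Local Notation "i ^s" := (lift ord0 i) (at level 1, format "i ^s").

(** In the simplicial identities the larger index is shifted down by one, so that
    all indices are in range: for instance [face_face] is
    [d_i d_(j+1) = d_j d_i] for [i <= j]. *)
Record simplicial_group := SimplicialGroup {
  sg_obj :> nat -> groupType;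
  face : forall n, 'I_n.+2 -> {hom sg_obj n.+1 -> sg_obj n};
  degen : forall n, 'I_n.+1 -> {hom sg_obj n -> sg_obj n.+1};
  face_face : forall n (i j : 'I_n.+2) (x : sg_obj n.+2), (i <= j)%N ->
    face i (face j^s x) = face j (face i^w x);
  degen_degen : forall n (i j : 'I_n.+1) (x : sg_obj n), (i <= j)%N ->
    degen i^w (degen j x) = degen j^s (degen i x);
  face_degen_lt : forall n (i : 'I_n.+2) (j : 'I_n.+1) (x : sg_obj n.+1),
    (i <= j)%N -> face i^w (degen j^s x) = degen j (face i x);
  face_degenw : forall n (i : 'I_n.+1) (x : sg_obj n),
    face i^w (degen i x) = x;
  face_degens : forall n (i : 'I_n.+1) (x : sg_obj n),
    face i^s (degen i x) = x;
  face_degen_gt : forall n (i : 'I_n.+2) (j : 'I_n.+1) (x : sg_obj n.+1),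
    (j < i)%N -> face i^s (degen j^w x) = degen j (face i x) }.

Arguments face {_ n} i.
Arguments degen {_ n} i.

Record simplicial_hom (K L : simplicial_group) := SimplicialHom {
  sh_hom :> forall n, {hom K n -> L n};
  sh_face : forall n (i : 'I_n.+2) x,
    sh_hom n (face i x) = face i (sh_hom n.+1 x);
  sh_degen : forall n (i : 'I_n.+1) x,
    sh_hom n.+1 (degen i x) = degen i (sh_hom n x) }.

Definition sh_surjective (K L : simplicial_group) (f : simplicial_hom K L) :=
  forall n (y : L n), exists x, f n x = y.

Section SimplicialKernel.
Variables (K L : simplicial_group) (f : simplicial_hom K L).

Let ker n := kernel (f n).

Fact ker_face n (i : 'I_n.+2) x : ker n.+1 x -> ker n (face i x).
Proof. by rewrite /= sh_face => ->; rewrite gmulf1. Qed.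

Fact ker_degen n (i : 'I_n.+1) x : ker n x -> ker n.+1 (degen i x).
Proof. by rewrite /= sh_degen => ->; rewrite gmulf1. Qed.

Definition simplicial_ker : simplicial_group.
Proof.
exists (fun n => subgrp (ker n) : groupType)
  (fun n i => sub_map (@ker_face n i)) (fun n i => sub_map (@ker_degen n i)).
- by move=> *; apply: val_inj; exact: face_face.
- by move=> *; apply: val_inj; exact: degen_degen.
- by move=> *; apply: val_inj; exact: face_degen_lt.
- by move=> *; apply: val_inj; exact: face_degenw.
- by move=> *; apply: val_inj; exact: face_degens.
- by move=> *; apply: val_inj; exact: face_degen_gt.
Defined.

End SimplicialKernel.

Section KerMap.
Variables (K L K' L' : simplicial_group).
Variables (a : simplicial_hom K L) (a' : simplicial_hom K' L').
Variables (f : simplicial_hom K K') (g : simplicial_hom L L').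
Hypothesis sq : forall n x, a' n (f n x) = g n (a n x).

Fact ker_sq n x : kernel (a n) x -> kernel (a' n) (f n x).
Proof. by rewrite /= sq => ->; exact: gmulf1. Qed.

Definition simplicial_ker_map :
  simplicial_hom (simplicial_ker a) (simplicial_ker a').
Proof.
exists (fun n => sub_map (@ker_sq n)).
- by move=> *; apply: val_inj; exact: sh_face.
- by move=> *; apply: val_inj; exact: sh_degen.
Defined.

End KerMap.

Section VerbalQuotient.
Variable V : set word.

Let verbalf (G H : groupType) (f : {hom G -> H}) :
  {hom quogrp (verbal V G) -> quogrp (verbal V H)} :=
  quo_map (N := verbal V G) (M := verbal V H) (@verbal_hom V G H f).

Definition verbal_quo (K : simplicial_group) : simplicial_group.
Proof.
exists (fun n => quogrp (verbal V (K n)) : groupType)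
  (fun n i => verbalf (face i)) (fun n i => verbalf (degen i)).
- by move=> n i j x ij; elim/quo_piP: x => x; rewrite !quo_mapE face_face.
- by move=> n i j x ij; elim/quo_piP: x => x; rewrite !quo_mapE degen_degen.
- by move=> n i j x ij; elim/quo_piP: x => x; rewrite !quo_mapE face_degen_lt.
- by move=> n i; apply: quo_piP => x; rewrite !quo_mapE face_degenw.
- by move=> n i; apply: quo_piP => x; rewrite !quo_mapE face_degens.
- by move=> n i j x ij; elim/quo_piP: x => x; rewrite !quo_mapE face_degen_gt.
Defined.

Definition verbal_quo_map (K L : simplicial_group) (f : simplicial_hom K L) :
  simplicial_hom (verbal_quo K) (verbal_quo L).
Proof.
exists (fun n => verbalf (f n)).
- by move=> n i; apply: quo_piP => x; rewrite !quo_mapE sh_face.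
- by move=> n i; apply: quo_piP => x; rewrite !quo_mapE sh_degen.
Defined.

Lemma verbal_quo_map_id (K : simplicial_group) (f : simplicial_hom K K) n :
  f n =1 id -> verbal_quo_map f n =1 id.
Proof.
move=> fE; apply: quo_piP => x; transitivity (quo_pi (verbal V _) (f n x)).
  exact: quo_mapE.
by rewrite fE.
Qed.

Lemma verbal_quo_map_comp (K L M : simplicial_group) (f : simplicial_hom K L)
    (g : simplicial_hom L M) (h : simplicial_hom K M) n :
  h n =1 g n \o f n ->
  verbal_quo_map h n =1 verbal_quo_map g n \o verbal_quo_map f n.
Proof.
move=> hE; apply: quo_piP => x; transitivity (quo_pi (verbal V _) (h n x)).
  exact: quo_mapE.
rewrite hE; symmetry.
transitivity (verbal_quo_map g n (quo_pi (verbal V _) (f n x))).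
  by congr (verbal_quo_map g n _); exact: quo_mapE.
exact: quo_mapE.
Qed.

End VerbalQuotient.

(** Homotopy groups are the homology groups of the Moore complex, normalised so
    that the chains of degree [n] are killed by all faces but the last one, which
    is the differential. *)
Section Homotopy.
Variable K : simplicial_group.

Definition moore n : set (K n) :=
  match n return set (K n) with
  | 0 => setT
  | m.+1 => [set x | forall i : 'I_m.+1, face i^w x = 1]
  end.

Definition moore_cycle_set n : set (K n) :=
  match n return set (K n) with
  | 0 => setT
  | m.+1 => [set x | moore x /\ face ord_max x = 1]
  end.

Definition moore_cycle n : subgroup (K n).
Proof.
exists (@moore_cycle_set n); case: n => [|n] //=.
- by split=> [i|]; rewrite gmulf1.
- move=> x y [mx dx] [my dy].
  by split=> [i|]; rewrite gmulfM ?mx ?my ?dx ?dy mulg1.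
- by move=> x [mx dx]; split=> [i|]; rewrite gmulfV ?mx ?dx invg1.
Defined.

Definition moore_boundary_subgroup n : subgroup (subgrp (moore_cycle n)).
Proof.
exists (fun x : subgrp (moore_cycle n) =>
  exists2 y : K n.+1, moore y & face ord_max y = val x).
- by exists 1 => [i|]; rewrite gmulf1.
- move=> x x' [y my dy] [y' my' dy']; exists (y * y') => [i|].
    by rewrite gmulfM my my' mulg1.
  by rewrite gmulfM dy dy'.
- move=> x [y my dy]; exists y^-1 => [i|]; first by rewrite gmulfV my invg1.
  by rewrite gmulfV dy gmulfV.
Defined.

Definition moore_boundary n : normal_subgroup (subgrp (moore_cycle n)).
Proof.
exists (moore_boundary_subgroup n) => x z [y my dy].
exists (y ^ degen ord_max (val z)) => [i|].
  by rewrite gmulfJ my /conjg mul1g mulVg.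
have e : ord_max = lift ord0 (@ord_max n) by apply: val_inj.
by rewrite gmulfJ dy e face_degens gmulfJ.
Defined.

Definition homotopy_group n : groupType := quogrp (moore_boundary n).

End Homotopy.

Section HomotopyMap.
Variables (K L : simplicial_group) (f : simplicial_hom K L).

Fact moore_map n (x : K n) : moore x -> moore (f n x).
Proof. by case: n x => [|n] //= x mx i; rewrite -sh_face mx gmulf1. Qed.

Fact moore_cycle_map n x : moore_cycle K n x -> moore_cycle L n (f n x).
Proof.
case: n x => [|n] //= x [mx dx].
by split; [exact: (@moore_map n.+1) | rewrite -sh_face dx gmulf1].
Qed.

Fact moore_boundary_map n x :
  moore_boundary K n x -> moore_boundary L n (sub_map (@moore_cycle_map n) x).
Proof.
move=> [y my dy]; exists (f n.+1 y); first exact: (@moore_map n.+1).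
by rewrite val_sub_map -dy sh_face.
Qed.

Definition homotopy_map n : {hom homotopy_group K n -> homotopy_group L n} := quo_map (@moore_boundary_map n).

End HomotopyMap.

Lemma homotopy_map_id (K : simplicial_group) (f : simplicial_hom K K) n :
  f n =1 id -> homotopy_map f n =1 id.
Proof.
move=> fE; apply: quo_piP => x; rewrite /homotopy_map quo_mapE /=.
by congr (quo_class _ _); apply: val_inj; exact: fE.
Qed.

Lemma homotopy_map_comp (K L M : simplicial_group) (f : simplicial_hom K L)
    (g : simplicial_hom L M) (h : simplicial_hom K M) n :
  h n =1 g n \o f n -> homotopy_map h n =1 homotopy_map g n \o homotopy_map f n.
Proof.
move=> hE; apply: quo_piP => x; rewrite /comp /homotopy_map !quo_mapE /=.
by congr (quo_class _ _); apply: val_inj; exact: hE.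
Qed.

Definition free_basis (G : groupType) (X : set G) : Prop :=
  forall (H : groupType) (f : G -> H),
    exists! u : {hom G -> H}, {in X, u =1 f}.

Definition free_simplicial (K : simplicial_group) : Prop :=
  exists X : forall n, set (K n),
    (forall n, free_basis (X n)) /\
    (forall n (i : 'I_n.+1) x, X n x -> X n.+1 (degen i x)).

(** Functoriality covers the identification [fr_aug] of [pi_0] with [G]: its
    naturality says that [fr_map f] induces [f].  Functoriality alone does not
    make the map of resolutions induced by [G -> G/N] an epimorphism, whence
    [fr_epi]. *)
Record free_resolution := FreeResolution {
  fr_obj :> groupType -> simplicial_group;
  fr_map : forall G H : groupType,
    {hom G -> H} -> simplicial_hom (fr_obj G) (fr_obj H);
  fr_map_id : forall (G : groupType) n, fr_map (@idfun G) n =1 id;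
  fr_map_comp : forall (G H K : groupType) (g : {hom H -> K})
    (f : {hom G -> H}) n, fr_map (g \o f) n =1 fr_map g n \o fr_map f n;
  fr_epi : forall (G H : groupType) (f : {hom G -> H}),
    (forall y, exists x, f x = y) -> sh_surjective (fr_map f);
  fr_free : forall G, free_simplicial (fr_obj G);
  fr_aug : forall G : groupType, {hom homotopy_group (fr_obj G) 0 -> G};
  fr_aug_bij : forall G, bijective (fr_aug G);
  fr_aug_nat : forall (G H : groupType) (f : {hom G -> H}) x,
    fr_aug H (homotopy_map (fr_map f) 0 x) = f (fr_aug G x);
  fr_acyclic : forall (G : groupType) m (x : homotopy_group (fr_obj G) m),
    (0 < m)%N -> x = 1 }.

Arguments fr_map R {G H} f : rename.
Arguments fr_map_id R G {n} : rename.
Arguments fr_map_comp R {G H K} g f {n} : rename.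
Arguments fr_aug R G : rename.
Arguments fr_acyclic R {G m} x _ : rename.

Record group_pair := GroupPair {
  gp_grp :> groupType;
  gp_sub : normal_subgroup gp_grp }.

Record pair_hom (P Q : group_pair) := PairHom {
  ph_hom :> {hom P -> Q};
  ph_sub : forall x, gp_sub P x -> gp_sub Q (ph_hom x) }.

Section Baer.
Variables (V : set word) (R : free_resolution).

Definition baer_alpha (P : group_pair) :
    simplicial_hom (R P) (R (quogrp (gp_sub P))) :=
  fr_map R (quo_pi (gp_sub P)).

Definition baer_ker (P : group_pair) : simplicial_group :=
  simplicial_ker (verbal_quo_map V (baer_alpha P)).

Definition baer (P : group_pair) : groupType := homotopy_group (baer_ker P) 1.

Section BaerMap.
Variables (P Q : group_pair) (f : pair_hom P Q).

Let fbar : {hom quogrp (gp_sub P) -> quogrp (gp_sub Q)} :=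
  quo_map (@ph_sub P Q f).

Fact baer_sq n x :
  verbal_quo_map V (baer_alpha Q) n (verbal_quo_map V (fr_map R f) n x) =
  verbal_quo_map V (fr_map R fbar) n (verbal_quo_map V (baer_alpha P) n x).
Proof.
move: x; apply: quo_piP => x; rewrite !quo_mapE; congr (quo_pi _ _).
have e : quo_pi (gp_sub Q) \o f = fbar \o quo_pi (gp_sub P) :> {hom _ -> _}.
  by apply: hom_ext => y; exact: (esym (quo_mapE (@ph_sub P Q f) y)).
rewrite /baer_alpha.
have /= <- := fr_map_comp R (quo_pi (gp_sub Q)) f x.
by rewrite e fr_map_comp.
Qed.

Definition baer_ker_map : simplicial_hom (baer_ker P) (baer_ker Q) :=
  simplicial_ker_map baer_sq.

Definition baer_map : {hom baer P -> baer Q} := homotopy_map baer_ker_map 1.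

End BaerMap.

Lemma baer_map_id (P : group_pair) (f : pair_hom P P) :
  f =1 id -> baer_map f =1 id.
Proof.
move=> fE; apply: homotopy_map_id => x; apply: val_inj.
apply: (@verbal_quo_map_id V _ (fr_map R f) 1) => y.
have -> : ph_hom f = @idfun P by apply: hom_ext.
exact: fr_map_id.
Qed.

Lemma baer_map_comp (P Q S : group_pair) (f : pair_hom P Q)
    (g : pair_hom Q S) (h : pair_hom P S) :
  h =1 g \o f -> baer_map h =1 baer_map g \o baer_map f.
Proof.
move=> hE; apply: homotopy_map_comp => x; apply: val_inj.
apply: (@verbal_quo_map_comp V _ _ _ (fr_map R f) (fr_map R g) (fr_map R h) 1).
move=> y; have -> : ph_hom h = ph_hom g \o ph_hom f by apply: hom_ext.
exact: fr_map_comp.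
Qed.

End Baer.

Definition directed_set d (I : preorderType d) : Prop :=
  inhabited I /\ forall i j : I, exists k, (i <= k)%O /\ (j <= k)%O.

Record direct_system d (I : preorderType d) := DirectSystem {
  ds_obj :> I -> groupType;
  ds_map : forall i j : I, (i <= j)%O -> {hom ds_obj i -> ds_obj j};
  ds_map_id : forall (i : I) (ii : (i <= i)%O), ds_map ii =1 id;
  ds_map_comp : forall (i j k : I) (ij : (i <= j)%O) (jk : (j <= k)%O)
    (ik : (i <= k)%O), ds_map ik =1 ds_map jk \o ds_map ij }.

Definition cocone d (I : preorderType d) (D : direct_system I) (L : groupType)
    (c : forall i, {hom D i -> L}) : Prop :=
  forall (i j : I) (ij : (i <= j)%O), c j \o ds_map D ij =1 c i.

Definition is_direct_limit d (I : preorderType d) (D : direct_system I)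
    (L : groupType) (c : forall i, {hom D i -> L}) : Prop :=
  cocone c /\
  forall (H : groupType) (e : forall i, {hom D i -> H}), cocone e ->
    exists! u : {hom L -> H}, forall i, u \o c i =1 e i.

Record pair_system d (I : preorderType d) := PairSystem {
  ps_obj :> I -> group_pair;
  ps_map : forall i j : I, (i <= j)%O -> pair_hom (ps_obj i) (ps_obj j);
  ps_map_id : forall (i : I) (ii : (i <= i)%O), ps_map ii =1 id;
  ps_map_comp : forall (i j k : I) (ij : (i <= j)%O) (jk : (j <= k)%O)
    (ik : (i <= k)%O), ps_map ik =1 ps_map jk \o ps_map ij }.

Definition ph_sub_map (P Q : group_pair) (f : pair_hom P Q) :
  {hom subgrp (gp_sub P) -> subgrp (gp_sub Q)} := sub_map (@ph_sub P Q f).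

Section SystemsOfPair.
Variables (d : Order.disp_t) (I : preorderType d) (D : pair_system I).

Definition grp_system : direct_system I :=
  DirectSystem (ds_obj := fun i => gp_grp (D i))
    (ds_map := fun i j ij => ph_hom (ps_map D ij))
    (@ps_map_id _ _ D) (@ps_map_comp _ _ D).

Definition sub_system : direct_system I.
Proof.
exists (fun i => subgrp (gp_sub (D i)) : groupType)
  (fun i j ij => ph_sub_map (ps_map D ij)).
- by move=> i ii x; apply: val_inj; exact: ps_map_id.
- by move=> i j k ij jk ik x; apply: val_inj; exact: ps_map_comp.
Defined.

Definition baer_system (V : set word) (R : free_resolution) :
  direct_system I.
Proof.
exists (fun i => baer V R (D i)) (fun i j ij => baer_map V R (ps_map D ij)).
- by move=> i ii; apply: baer_map_id; exact: ps_map_id.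
- by move=> i j k ij jk ik; apply: baer_map_comp; exact: ps_map_comp.
Defined.

(** [P] is [(lim G_i, lim N_i)]: its normal subgroup is the direct limit of the
    [N_i] as groups, along the restrictions of the cocone of the [G_i]. *)
Definition is_direct_limit_pair (P : group_pair)
    (c : forall i, pair_hom (D i) P) : Prop :=
  @is_direct_limit _ _ grp_system P c /\
  @is_direct_limit _ _ sub_system (subgrp (gp_sub P))
    (fun i => ph_sub_map (c i)).

End SystemsOfPair.

Definition isomorphic (G H : groupType) : Prop :=
  exists f : {hom G -> H}, bijective f.

(* Main.v *)
(** The functor [R] need not commute with direct limits, so a homomorphism from
    the resolution of the limit back to that of some [G_i] is only constructed
    on finitely many elements at a time, using freeness.

    Let [F] and [H] be the groups of vertices of the resolutions [K] of [G] and
    [L] of [G/N].  As [K -> L] is onto in each degree and both sides are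
    aspherical, every element of the Baer invariant is the class of an edge in
    the kernel of [K -> L] from [1] to some [w] in [V(F)] which is trivial in
    [H] and in [G], and it vanishes iff such an edge can be found in [V(K_1)].
    Each such [w], and each such edge, involves only finitely many free
    generators.  On these one lifts to [G_i], for [i] large, compatibly with
    lifts of the generators of [H], and two such lifts are joined by a homotopy
    which is itself a homomorphism [F -> K_1], so it sends [V(F)] into [V(K_1)];
    its component in [L_1] factors through [H] and so is trivial on [w].  This
    gives surjectivity and injectivity of [lim VM(G_i, N_i) -> VM(G, N)]. *)
Require Import Defs.
From HB Require Import structures.
From mathcomp Require Import all_boot all_order.
From mathcomp Require Import boolp classical_sets.

Set Implicit Arguments.
Unset Strict Implicit.
Unset Printing Implicit Defensive.

Import Order.Theory.

Local Open Scope group_scope.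

Local Notation "i ^w" := (widen_ord (leqnSn _) i)
  (at level 1, format "i ^w").
Local Notation "i ^s" := (lift ord0 i) (at level 1, format "i ^s").

Lemma quo_pi_eq1 (G : groupType) (N : normal_subgroup G) x :
  quo_pi N x = 1 <-> N x.
Proof.
have e : quo_pi N 1 = 1 by exact: gmulf1.
have [f g] := quo_pi_eq N 1 x; rewrite invg1 mul1g e in f g.
by split=> [/esym|/g].
Qed.

(** * Finite supports in free groups *)

Section FreeGroups.

(** A stand-in for membership in the subgroup generated by [Z], which avoids reduced words. *)
Definition supported (G : groupType) (Z : seq G) (x : G) : Prop :=
  forall (H : groupType) (f g : {hom G -> H}), {in Z, f =1 g} -> f x = g x.

Lemma supported_subset (G : groupType) (Z Z' : seq G) x :
  {subset Z <= Z'} -> supported Z x -> supported Z' x.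
Proof. by move=> sZ Zx H f g fg; apply: Zx => z /sZ; exact: fg. Qed.

Definition support_subgroup (G : groupType) (X : set G) : subgroup G.
Proof.
exists (fun x => exists2 Z : seq G, (forall z, z \in Z -> X z) & supported Z x).
- by exists [::] => // H f g _; rewrite !gmulf1.
- move=> x y [Z ZX Zx] [Z' ZX' Zy]; exists (Z ++ Z') => [z|H f g fg].
    by rewrite mem_cat => /orP[/ZX|/ZX'].
  by rewrite !gmulfM (Zx _ f g) ?(Zy _ f g) // => z Zz;
    apply: fg; rewrite mem_cat Zz ?orbT.
- by move=> x [Z ZX Zx]; exists Z => // H f g fg; rewrite !gmulfV (Zx _ f g).
Defined.

(** The elements supported by finite parts of [X] form a subgroup [S] containing [X]. Freeness gives
    [u] into [S] fixing [X]; followed by the inclusion it agrees with the identity on [X], hence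
    everywhere, so [S] is the whole group. *)
Lemma free_support (G : groupType) (X : set G) x : free_basis X ->
  exists2 Z : seq G, (forall z, z \in Z -> X z) & supported Z x.
Proof.
move=> freeX; pose S := support_subgroup X.
have XS z : X z -> S z.
  move=> Xz; exists [:: z] => [y|H f g fg]; first by rewrite inE => /eqP->.
  by apply: fg; rewrite inE.
(* Off [X] the condition is vacuous and 1 serves as witness. *)
have /choice[f fP] z : exists y : subgrp S, X z -> val y = z.
  by have [/XS Sz|nX] := pselect (X z); [exists (to_subgrp Sz)|exists 1].
have valM : {morph (val : subgrp S -> G) : a b / a * b} by [].
have [u [uf _]] := freeX _ f.
have [v [_ uniq_v]] := freeX _ id.
suff <- : val (u x) = x by exact: (subgrpP (u x)).
have e1 := uniq_v (@idfun G) (fun _ _ => erefl).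
have e2 : v = hom_of valM \o u.
  by apply: uniq_v => z Xz /=; rewrite uf // fP //; exact: set_mem.
by have := congr1 (fun h : {hom G -> G} => h x) (etrans (esym e2) e1).
Qed.

Lemma free_support_seq (G : groupType) (X : set G) (s : seq G) : free_basis X ->
  exists2 Z : seq G, (forall z, z \in Z -> X z) &
    {in s, forall x, supported Z x}.
Proof.
move=> freeX; elim: s => [|x s [Z ZX Zs]]; first by exists [::].
have [Z' ZX' Zx] := free_support x freeX.
exists (Z' ++ Z) => [z|y]; first by rewrite mem_cat => /orP[/ZX'|/ZX].
rewrite inE => /orP[/eqP->|/Zs ys].
  by apply: supported_subset Zx => z Zz; rewrite mem_cat Zz.
by apply: supported_subset ys => z Zz; rewrite mem_cat Zz orbT.
Qed.

Lemma choice_seq (A B : choiceType) (b : B) (s : seq A) (T : A -> B -> Prop) :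
  {in s, forall x, exists y, T x y} ->
  exists f, {in s, forall x, T x (f x)}.
Proof.
move=> sT; have /choice[f fP] x : exists y, x \in s -> T x y.
  by have [/sT[y Ty]|] := boolP (x \in s); [exists y | exists b].
by exists f.
Qed.

(** Maps out of a resolution that functoriality does not supply are built this way, with conditions
    at finitely many generators only. *)
Lemma free_extend (G H : groupType) (X : set G) (Z : seq G)
    (T : G -> H -> Prop) :
  free_basis X -> (forall z, z \in Z -> X z) ->
  {in Z, forall z, exists h, T z h} ->
  exists u : {hom G -> H}, {in Z, forall z, T z (u z)}.
Proof.
move=> freeX ZX /(choice_seq 1)[f fP]; have [u [uf _]] := freeX _ f.
by exists u => z Zz; rewrite uf; [exact: fP | exact/mem_set/ZX].
Qed.

End FreeGroups.

(** * Surjections of simplicial groups *)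

Section Simplicial.

(** By d_i s_j d_j = s_(j-1) d_(j-1) d_i, the correction made in [moore_lift] leaves the earlier
    trivial faces trivial. *)
Lemma face_degen_face (K : simplicial_group) n (i j : 'I_n.+1) (x : K n.+1) :
  (i < j)%N -> face i^w x = 1 -> face i^w (degen j (face j^w x)) = 1.
Proof.
case: n i j x => [|n] i j x ij dx; first by move: ij; rewrite !ord1.
case: (unliftP ord0 j) ij => [k ->|-> //]; rewrite ltnS => ik.
rewrite face_degen_lt //; have -> : (k^s)^w = (k^w)^s by apply: val_inj.
by rewrite face_face // dx !gmulf1.
Qed.

(** Take any preimage [x] and divide by s_j d_j x for j = 0, 1, ... in turn. Each divisor maps to
    s_j d_j y = 1, so the image stays [y]. *)
Lemma moore_lift (K L : simplicial_group) (f : simplicial_hom K L) n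
    (y : L n.+1) :
  sh_surjective f -> moore y -> exists2 x : K n.+1, moore x & f _ x = y.
Proof.
move=> surjf my.
(* Induction on the number [r] of leading faces already made trivial. *)
suff /(_ n.+1 (leqnn _))[x fx dx] : forall r, (r <= n.+1)%N ->
    exists2 x, f _ x = y & forall i : 'I_n.+1, (i < r)%N -> face i^w x = 1.
  by exists x => // i; apply: dx.
elim=> [_|r IH rn]; first by have [x fx] := surjf _ y; exists x.
have [x fx dx] := IH (ltnW rn); pose j := Ordinal rn.
exists (x * (degen j (face j^w x))^-1) => [|i].
  by rewrite gmulfM gmulfV sh_degen sh_face fx my gmulf1 invg1 mulg1.
rewrite ltnS leq_eqVlt => /orP[/eqP ir|ir].
  have -> : i = j by apply: val_inj.
  by rewrite gmulfM gmulfV face_degenw mulgV.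
by rewrite gmulfM gmulfV (dx i) // mul1g face_degen_face ?invg1 ?dx.
Qed.

Lemma cycle_face (K : simplicial_group) n (x : K n.+1) :
  moore_cycle K n.+1 x <-> forall i, face i x = 1.
Proof.
split=> [[mx dx] i|dx]; last by split=> [i|]; exact: dx.
case: (unliftP ord_max i) => [j ->|-> //]; rewrite -(mx j); congr (face _ _).
by apply: val_inj; rewrite /= /bump leqNgt ltn_ord.
Qed.

Lemma face_max_moore (K : simplicial_group) n (x : K n.+2) :
  moore x -> forall i, face i (face ord_max x) = 1.
Proof.
move=> mx i; have -> : ord_max = (@ord_max n.+1)^s by apply: val_inj.
by rewrite face_face ?mx ?gmulf1 // -ltnS.
Qed.

Definition acyclic (K : simplicial_group) n :=
  forall x : homotopy_group K n, x = 1.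

Lemma acyclic_boundary (K : simplicial_group) n (x : K n.+1) : acyclic K n.+1 ->
  (forall i, face i x = 1) -> exists2 y, moore y & face ord_max y = x.
Proof.
move=> acK /cycle_face cx.
have /quo_pi_eq : quo_pi (moore_boundary K n.+1) 1 =
    quo_pi (moore_boundary K n.+1) (to_subgrp cx).
  exact: etrans (acK _) (esym (acK _)).
by case=> y my; rewrite invg1 mul1g; exists y.
Qed.

Section Surjection.
Variables (K L : simplicial_group) (f : simplicial_hom K L).
Hypothesis surjf : sh_surjective f.

(** The kernel inherits asphericity: if [x] bounds [k] in [K], then [f x] is a cycle, hence bounds
    some [y]; lift [y] to [z] and divide [x] by the differential of [z]. *)
Lemma kernel_boundary n (k : K n.+1) : acyclic K n.+1 -> acyclic L n.+2 ->
  f _ k = 1 -> (forall i, face i k = 1) ->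
  exists2 x, moore x & f _ x = 1 /\ face ord_max x = k.
Proof.
move=> acK acL fk dk; have [x mx dx] := acyclic_boundary acK dk.
have [|y my dy] := @acyclic_boundary _ _ (f _ x) acL.
  apply/cycle_face; split=> [i|]; first by rewrite -sh_face mx gmulf1.
  by rewrite -sh_face dx.
have [z mz fz] := moore_lift surjf my.
exists (x * (face ord_max z)^-1) => [i|].
  by rewrite gmulfM gmulfV mx face_max_moore // invg1 mulg1.
rewrite !gmulfM !gmulfV sh_face fz dy mulgV face_max_moore // dx invg1 mulg1.
by [].
Qed.

(** The quotient of [l] by [f k] is a cycle, hence a boundary, and lifts to a boundary in [K], whose
    faces are all trivial. *)
Lemma adjust_image n (k : K n.+1) (l : L n.+1) : acyclic L n.+1 ->
  (forall i, face i l = face i (f _ k)) ->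
  exists2 k', f _ k' = l & forall i, face i k' = face i k.
Proof.
move=> acL dl; have [|y my dy] := @acyclic_boundary _ _ ((f _ k)^-1 * l) acL.
  by move=> i; rewrite gmulfM gmulfV dl mulVg.
have [x mx fx] := moore_lift surjf my.
exists (k * face ord_max x) => [|i].
  by rewrite gmulfM sh_face fx dy mulVKg.
by rewrite gmulfM face_max_moore // mulg1.
Qed.

End Surjection.

End Simplicial.
(** * Low degrees of a free resolution *)

Section Resolution.
Variable R : free_resolution.

Definition vertex_fun (K : simplicial_group) (x : K 0) : homotopy_group K 0 :=
  quo_pi (moore_boundary K 0) (@to_subgrp _ (moore_cycle K 0) x Logic.I).

Fact vertex_funM (K : simplicial_group) : {morph @vertex_fun K : x y / x * y}.
Proof.
by move=> x y; rewrite /vertex_fun -gmulfM; congr (quo_pi _ _); apply: val_inj.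
Qed.

Definition vertex (K : simplicial_group) := hom_of (@vertex_funM K).

Definition aug (G : groupType) : {hom R G 0 -> G} := 
  locked (fr_aug R G \o vertex (R G) : {hom R G 0 -> G}).

Lemma augE (G : groupType) x : aug G x = fr_aug R G (vertex (R G) x).
Proof. by rewrite /aug -lock. Qed.

Lemma aug_surj (G : groupType) g : exists x, aug G x = g.
Proof.
have [h _ hK] := fr_aug_bij R G; rewrite -(hK g).
elim/quo_piP: (h g) => x; exists (val x); rewrite augE.
by congr (fr_aug R G (quo_pi _ _)); apply: val_inj.
Qed.

Lemma face0_degen (K : simplicial_group) (x : K 0) :
  face ord0 (degen ord0 x) = x.
Proof.
by rewrite -[RHS](face_degenw ord0); congr (face _ _); apply: val_inj.
Qed.

Lemma face1_degen (K : simplicial_group) (x : K 0) :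
  face ord_max (degen ord0 x) = x.
Proof.
by rewrite -[RHS](face_degens ord0); congr (face _ _); apply: val_inj.
Qed.

Lemma moore1E (K : simplicial_group) (x : K 1%N) : moore x <-> face ord0 x = 1.
Proof.
have e : (@ord0 0)^w = ord0 by apply: val_inj.
by split=> [mx|dx i]; [rewrite -e; exact: mx | rewrite ord1 e].
Qed.

(** An edge from [a] to [b] is a Moore chain with boundary a^-1 b, translated by the degenerate edge
    at [a]. *)
Lemma aug_eq (G : groupType) (a b : R G 0) :
  aug G a = aug G b <->
  exists2 k : R G 1%N, face ord0 k = a & face ord_max k = b.
Proof.
have -> : aug G a = aug G b <-> vertex (R G) a = vertex (R G) b.
  by rewrite !augE; split=> [/(bij_inj (fr_aug_bij R G))|->].
rewrite /vertex /= /vertex_fun; split=> [/quo_pi_eq|[k da db]].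
  case=> y /moore1E y0 /= dy; exists (degen ord0 a * y).
    by rewrite gmulfM face0_degen y0 mulg1.
  by rewrite gmulfM face1_degen dy mulVKg.
apply/quo_pi_eq; exists ((degen ord0 a)^-1 * k).
  by apply/moore1E; rewrite gmulfM gmulfV face0_degen da mulVg.
by rewrite gmulfM gmulfV face1_degen db.
Qed.

Lemma aug_nat (G H : groupType) (f : {hom G -> H}) x :
  aug H (fr_map R f 0 x) = f (aug G x).
Proof.
rewrite !augE -fr_aug_nat; congr (fr_aug R H _).
rewrite /homotopy_map quo_mapE; congr (quo_pi _ _); exact: val_inj.
Qed.

Lemma fr_mapE (G H K : groupType) (g : {hom H -> K}) (f : {hom G -> H})
    (h : {hom G -> K}) n (x : R G n) :
  h =1 g \o f -> fr_map R h n x = fr_map R g n (fr_map R f n x).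
Proof.
move=> hE; have -> : h = g \o f by apply: hom_ext.
exact: fr_map_comp.
Qed.

Lemma resolution_acyclic (G : groupType) n : acyclic (R G) n.+1.
Proof. by move=> x; exact: fr_acyclic. Qed.

Lemma resolution_basis (G : groupType) n : exists X, @free_basis (R G n) X.
Proof. by have [X [fX _]] := fr_free R G; exists (X n). Qed.

Lemma ord2_ind (T : 'I_2 -> Prop) : T ord0 -> T ord_max -> forall i, T i.
Proof.
by move=> T0 T1 i; case: (unliftP ord0 i) => [j|] ->; rewrite ?ord1 //;
  move: T1; congr T; apply: val_inj.
Qed.

Section PairResolution.
Variable P : group_pair.

Definition pair_quo : groupType := quogrp (gp_sub P).

Local Notation alpha := (baer_alpha R P).

Lemma alpha_surj : sh_surjective alpha.
Proof. by apply: fr_epi; elim/quo_piP=> x; exists x. Qed.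

Lemma aug_alpha f : aug pair_quo (alpha 0 f) = quo_pi (gp_sub P) (aug P f).
Proof. exact: aug_nat. Qed.

(** Equal augmentations give some edge from [a] to [b]; asphericity of the quotient resolution lets
    [adjust_image] place it over [l]. *)
Lemma edge_lift (a b : R P 0) (l : R pair_quo 1%N) :
  aug P a = aug P b -> face ord0 l = alpha 0 a -> face ord_max l = alpha 0 b ->
  exists k : R P 1%N,
    [/\ face ord0 k = a, face ord_max k = b & alpha 1%N k = l].
Proof.
move=> /aug_eq[k da db] la lb.
have [|k' ak dk] :=
  @adjust_image _ _ _ alpha_surj 0 k l (@resolution_acyclic _ _).
  by apply: ord2_ind; rewrite -sh_face ?da ?db.
by exists k'; rewrite !dk.
Qed.

(** A lift [f] of [h] has an augmentation off by an element of N. Let [a] have this element as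
    augmentation: its image is joined to 1 by an edge, which lifts to an edge [k] starting at 1. The
    end of [k] has the image of [a] but trivial augmentation, so [a] divided by it corrects [f]. *)
Lemma vertex_lift (h : R pair_quo 0) (g : P) :
  aug pair_quo h = quo_pi (gp_sub P) g ->
  exists f : R P 0, alpha 0 f = h /\ aug P f = g.
Proof.
have [f fh] := alpha_surj h; rewrite -fh aug_alpha => /quo_pi_eq Nfg.
have [a aE] := aug_surj ((aug P f)^-1 * g).
have /aug_eq[l l0 l1] : aug pair_quo 1 = aug pair_quo (alpha 0 a).
  by rewrite gmulf1 aug_alpha aE; apply/esym/quo_pi_eq1.
have [k /moore1E k0 kl] := moore_lift alpha_surj (proj2 (moore1E l) l0).
have : aug P (face ord0 k) = aug P (face ord_max k) by apply/aug_eq; exists k.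
rewrite k0 gmulf1 => k1.
exists (f * (a * (face ord_max k)^-1)); split.
  by rewrite !gmulfM gmulfV sh_face kl l1 mulgV mulg1.
by rewrite !gmulfM gmulfV -k1 aE invg1 mulg1 mulVKg.
Qed.

End PairResolution.

End Resolution.
(** * Elements of the Baer invariant *)

Lemma quo_pi_surj (G : groupType) (N : normal_subgroup G) y :
  exists x, quo_pi N x = y.
Proof. by elim/quo_piP: y => x; exists x. Qed.

Section BaerClasses.
Variables (V : set word) (R : free_resolution).

Definition image_verbal (G H : groupType) (f : {hom G -> H}) : subgroup H.
Proof.
exists (fun y => exists2 x, verbal V G x & f x = y).
- by exists 1; [exact: sg1 | exact: gmulf1].
- move=> _ _ [x Vx <-] [y Vy <-].
  by exists (x * y); [exact: sgM | exact: gmulfM].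
- by move=> _ [x Vx <-]; exists x^-1; [exact: sgV | exact: gmulfV].
Defined.

(** Values of laws lift to values of the same laws, so the image of V(G) is a subgroup containing
    all of them. *)
Lemma verbal_surj (G H : groupType) (f : {hom G -> H}) y :
  (forall z, exists x, f x = z) -> verbal V H y ->
  exists2 x, verbal V G x & f x = y.
Proof.
move=> /choice[s sK] Vy; apply: (Vy (image_verbal f)) => w g Vw.
exists (word_eval (s \o g) w); first by move=> S; apply.
by rewrite word_eval_hom; congr word_eval; apply: funext => n /=.
Qed.

Definition verbal_pi (K : simplicial_group) :
  simplicial_hom K (verbal_quo V K).
Proof.
exists (fun n => quo_pi (verbal V (K n))) => n i x; symmetry;
  exact: quo_mapE.
Defined.

Lemma verbal_pi_nat (K L : simplicial_group) (f : simplicial_hom K L) n x :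
  verbal_quo_map V f n (verbal_pi K n x) = verbal_pi L n (f n x).
Proof. exact: quo_mapE. Qed.

Section Pair.
Variable P : group_pair.

Local Notation alpha := (baer_alpha R P).
Local Notation qK n := (quo_pi (verbal V (R P n))).

Definition ker_proj : simplicial_hom (simplicial_ker alpha) (baer_ker V R P) :=
  simplicial_ker_map (@verbal_pi_nat _ _ alpha).

(** A representative [x] has image in V(L); divide it by an element of V(K) with the same image. *)
Lemma ker_proj_surj : sh_surjective ker_proj.
Proof.
move=> n y; have [x xy] := quo_pi_surj (val y).
have : verbal_quo_map V alpha n (val y) = 1 := subgrpP y.
rewrite -xy [LHS]quo_mapE => /quo_pi_eq1 Vx.
have [x' Vx' ax'] := verbal_surj (alpha_surj (n := n)) Vx.
have kx : kernel (alpha n) (x * x'^-1) by rewrite /= gmulfM gmulfV ax' mulgV.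
exists (to_subgrp kx); apply: val_inj; rewrite -xy /=.
by apply/quo_classE; rewrite invgM invgK -mulgA mulVg mulg1.
Qed.

(** An element [xi] is handled through any [w] with [classifies w xi]; then
    [xi = 1] iff [null w]. *)
Definition classifies (w : R P 0) (xi : baer V R P) : Prop :=
  exists k : R P 1%N, exists z : subgrp (moore_cycle (baer_ker V R P) 1),
    [/\ face ord0 k = 1, face ord_max k = w, alpha 1%N k = 1,
        val (val z) = qK 1%N k & quo_pi (moore_boundary _ _) z = xi].

Definition null (w : R P 0) : Prop :=
  exists t : R P 1%N, [/\ verbal V (R P 1%N) t, face ord0 t = 1,
    face ord_max t = w & alpha 1%N t = 1].

Definition relator (w : R P 0) : Prop :=
  [/\ verbal V (R P 0) w, alpha 0 w = 1 & aug R P w = 1].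

(** Lift a representing cycle to an edge in the kernel of [alpha] starting at 1; its end [w] is
    trivial modulo V. *)
Lemma classifies_relator xi : exists2 w, relator w & classifies w xi.
Proof.
have [z <-] := quo_pi_surj xi.
have [mz dz] := subgrpP z.
have [x /moore1E mx xz] := moore_lift ker_proj_surj mz.
have d0 : face ord0 (val x) = 1 := congr1 val mx.
have ax : alpha 1%N (val x) = 1 := subgrpP x.
exists (face ord_max (val x)); last by exists (val x), z; rewrite -xz.
split.
- apply/quo_pi_eq1; apply: etrans (congr1 val dz); by rewrite -xz -sh_face.
- by rewrite sh_face ax gmulf1.
- rewrite -(gmulf1 (s := aug R P)) -d0; symmetry; apply/aug_eq.
  by exists (val x).
Qed.

(** Lift the trivial edge to one from 1 to [w]; modulo V it is a cycle. *)
Lemma relator_classifies w : relator w -> exists xi, classifies w xi.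
Proof.
move=> [Vw aw w1].
have [|||k [k0 kw ak]] := @edge_lift R P 1 w 1; rewrite ?gmulf1 //.
have kk : kernel (verbal_quo_map V alpha 1%N) (qK 1%N k).
  by apply: etrans (quo_mapE _ _) _; rewrite ak gmulf1.
have cz : moore_cycle (baer_ker V R P) 1 (to_subgrp kk).
  apply/cycle_face; apply: ord2_ind; apply: val_inj => /=.
    apply: etrans (esym (sh_face (verbal_pi (R P)) ord0 k)) _.
    by rewrite k0 gmulf1.
  apply: etrans (esym (sh_face (verbal_pi (R P)) ord_max k)) _.
  by rewrite kw; exact/quo_pi_eq1.
by exists (quo_pi (moore_boundary _ _) (to_subgrp cz)), k, (to_subgrp cz).
Qed.

(** The edge k^-1 k' t^-1 is a cycle in the kernel of [alpha], hence a boundary there; modulo V the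
    factor [t] disappears. *)
Lemma classifies_eq w w' xi xi' : classifies w xi -> classifies w' xi' ->
  null (w^-1 * w') -> xi = xi'.
Proof.
move=> [k [z [k0 kw ak zk <-]]] [k' [z' [k0' kw' ak' zk' <-]]].
move=> [t [Vt t0 tw at1]]; apply/quo_pi_eq.
have [||||x mx [ax dx]] := @kernel_boundary _ _ _ (alpha_surj (P := P)) 0
    (k^-1 * k' * t^-1).
- exact: resolution_acyclic.
- exact: resolution_acyclic.
- by rewrite !gmulfM !gmulfV ak ak' at1 !(invg1, mulg1).
- apply: ord2_ind; rewrite !gmulfM !gmulfV ?k0 ?k0' ?t0 ?kw ?kw' ?tw.
    by rewrite !(invg1, mulg1).
  exact: mulgV.
have kx : kernel (alpha 2%N) x by [].
exists (ker_proj 2%N (to_subgrp kx)) => [i|].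
  rewrite -sh_face -(gmulf1 (s := ker_proj 1%N)); congr (ker_proj 1%N _).
  by apply: val_inj => /=; exact: mx.
rewrite -sh_face; apply: val_inj; rewrite /= dx zk zk' -gmulfV -gmulfM.
apply/quo_classE; rewrite invgM invgK -mulgA.
by rewrite mulVg mulg1.
Qed.

Lemma classifies1 : classifies 1 1.
Proof. by exists 1, 1; rewrite !gmulf1. Qed.

Lemma classifies_null w xi : classifies w xi -> null w -> xi = 1.
Proof.
move=> wxi w1; symmetry; apply: classifies_eq classifies1 wxi _.
by rewrite invg1 mul1g.
Qed.

(** Lift the chain bounding the cycle to the kernel of [alpha]. Its differential has trivial faces
    and agrees with [k] modulo V, so dividing [k] by it leaves the ends unchanged and gives an edge
    in V(K_1). *)
Lemma null_classifies w : classifies w 1 -> null w.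
Proof.
move=> [k [z [k0 kw ak zk /quo_pi_eq1[y my dy]]]].
have [x mx xy] := moore_lift ker_proj_surj my.
have dx i : face i (face ord_max (val x)) = 1.
  by have := congr1 val (face_max_moore mx i).
have ax : alpha 2%N (val x) = 1 := subgrpP x.
exists ((face ord_max (val x))^-1 * k); split.
- apply/quo_pi_eq; rewrite -zk -dy -xy -sh_face; exact: erefl.
- by rewrite gmulfM gmulfV dx k0 invg1 mulg1.
- by rewrite gmulfM gmulfV dx kw invg1 mul1g.
- by rewrite gmulfM gmulfV ak sh_face ax gmulf1 invg1 mulg1.
Qed.

Lemma nullM w w' : null w -> null w' -> null (w * w').
Proof.
move=> [t [Vt t0 tw at1]] [t' [Vt' t0' tw' at1']]; exists (t * t'); split.
- exact: sgM.
- by rewrite gmulfM t0 t0' mulg1.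
- by rewrite gmulfM tw tw'.
- by rewrite gmulfM at1 at1' mulg1.
Qed.

(** Translate [t] by the degenerate edge at its start, which is also in V(K_1). *)
Lemma null_homotopy (t : R P 1%N) : verbal V (R P 1%N) t -> alpha 1%N t = 1 ->
  null ((face ord0 t)^-1 * face ord_max t).
Proof.
move=> Vt at1; exists ((degen ord0 (face ord0 t))^-1 * t); split.
- by apply: sgM => //; apply: sgV; do 2!apply: verbal_hom.
- by rewrite gmulfM gmulfV face0_degen mulVg.
- by rewrite gmulfM gmulfV face1_degen.
- by rewrite gmulfM gmulfV sh_degen sh_face !at1 !gmulf1 invg1 mulg1.
Qed.

End Pair.

(** * Naturality in the pair *)

Definition pair_quo_map (P Q : group_pair) (f : pair_hom P Q) :
  {hom pair_quo P -> pair_quo Q} := quo_map (@ph_sub P Q f).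

Lemma alpha_nat (P Q : group_pair) (f : pair_hom P Q) n x :
  baer_alpha R Q n (fr_map R f n x) =
  fr_map R (pair_quo_map f) n (baer_alpha R P n x).
Proof.
have e : quo_pi (gp_sub Q) \o f =1 pair_quo_map f \o quo_pi (gp_sub P).
  by move=> y; exact: esym (quo_mapE (@ph_sub P Q f) y).
transitivity (fr_map R (quo_pi (gp_sub Q) \o f) n x).
  by symmetry; exact: fr_mapE.
exact: fr_mapE.
Qed.

Lemma classifies_map (P Q : group_pair) (f : pair_hom P Q) w xi :
  classifies w xi -> classifies (fr_map R f 0 w) (baer_map V R f xi).
Proof.
move=> [k [z [k0 kw ak zk <-]]]; exists (fr_map R f 1%N k).
exists (Defs.sub_map (@moore_cycle_map _ _ (baer_ker_map V R f) 1) z); split.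
- by rewrite -sh_face k0 gmulf1.
- by rewrite -sh_face kw.
- by rewrite alpha_nat ak gmulf1.
- by rewrite /= zk; exact: (verbal_pi_nat (fr_map R f) k).
- by symmetry; exact: quo_mapE.
Qed.

End BaerClasses.
(** Since [Z] and [Z'] depend on [t] alone, [p0], [p1], [q0], [q1] may be chosen
    afterwards, to be good on [Z] and [Z'] only. *)
Lemma finite_homotopy (R : free_resolution) (E E' : groupType)
    (a : {hom E -> E'}) (X : set E) (X' : set E') (t : E) :
  free_basis X -> free_basis X' ->
  exists (Z : seq E) (Z' : seq E'), forall (V : set word) (Q : group_pair)
    (p0 p1 : {hom E -> R Q 0}) (q0 q1 : {hom E' -> R (pair_quo Q) 0}),
  {in Z, forall z, [/\ baer_alpha R Q 0 (p0 z) = q0 (a z),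
     baer_alpha R Q 0 (p1 z) = q1 (a z) & aug R Q (p0 z) = aug R Q (p1 z)]} ->
  {in Z', forall z, aug R _ (q0 z) = aug R _ (q1 z)} ->
  verbal V E t -> a t = 1 ->
  exists t' : R Q 1%N, [/\ verbal V (R Q 1%N) t', face ord0 t' = p0 t,
    face ord_max t' = p1 t & baer_alpha R Q 1%N t' = 1].
Proof.
move=> freeX freeX'; have [Z ZX Zt] := free_support t freeX.
(* [Z'] supports the images of [Z], so conditions on [Z'] control the maps from [E'] at these
   images. *)
have [Z' ZX' Za] := free_support_seq [seq a z | z <- Z] freeX'.
exists Z, Z' => V Q p0 p1 q0 q1 pZ qZ Vt at1.
(* [T] is a homotopy from [q0] to [q1] on [Z']. *)
have [|T TZ] := @free_extend _ (R (pair_quo Q) 1%N) _ Z'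
    (fun z l => face ord0 l = q0 z /\ face ord_max l = q1 z) freeX' ZX'.
  by move=> z /qZ/aug_eq[l l0 l1]; exists l.
have TaZ z : z \in Z -> face ord0 (T (a z)) = q0 (a z) /\
    face ord_max (T (a z)) = q1 (a z).
  move=> Zz; have {}Za := Za _ (map_f a Zz).
  split; [apply: (Za _ (face ord0 \o T))|apply: (Za _ (face ord_max \o T))];
    by move=> y /TZ[].
(* [k] is a homotopy from [p0] to [p1] on [Z], lying over [T \o a], which is trivial at [t]. *)
have [|k kZ] := @free_extend _ (R Q 1%N) _ Z (fun z k => [/\ face ord0 k = p0 z,
    face ord_max k = p1 z & baer_alpha R Q 1%N k = T (a z)]) freeX ZX.
  move=> z Zz; have [e0 e1 e2] := pZ z Zz; have [d0 d1] := TaZ z Zz.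
  by apply: edge_lift; rewrite ?e0 ?e1.
exists (k t); split.
- exact: verbal_hom.
- by apply: (Zt _ (face ord0 \o k)) => z /kZ[].
- by apply: (Zt _ (face ord_max \o k)) => z /kZ[].
- have -> : baer_alpha R Q 1%N (k t) = T (a t).
    by apply: (Zt _ (baer_alpha R Q 1%N \o k) (T \o a)) => z /kZ[].
  by rewrite at1 gmulf1.
Qed.

(** * Direct limits *)

(** The concrete model of the direct limit needed for [limit_separated] lives in
    the product of the [D i] modulo families that are eventually trivial. *)
Section ReducedProduct.
Variables (d : Order.disp_t) (I : preorderType d).

Definition family (D : I -> groupType) : Type := forall i, D i.

HB.instance Definition _ D := Choice.on (family D).

Section Family.
Variable D : I -> groupType.

Let famM (x y : family D) : family D := fun i => x i * y i.
Let fam1 : family D := fun i => 1.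
Let famV (x : family D) : family D := fun i => (x i)^-1.

Fact familyA : associative famM.
Proof.
by move=> x y z; apply: functional_extensionality_dep => i; exact: mulgA.
Qed.
Fact family1m : left_id fam1 famM.
Proof.
by move=> x; apply: functional_extensionality_dep => i; exact: mul1g.
Qed.
Fact familym1 : right_id fam1 famM.
Proof.
by move=> x; apply: functional_extensionality_dep => i; exact: mulg1.
Qed.
Fact familyVm : left_inverse fam1 famV famM.
Proof.
by move=> x; apply: functional_extensionality_dep => i; exact: mulVg.
Qed.
Fact familymV : right_inverse fam1 famV famM.
Proof.
by move=> x; apply: functional_extensionality_dep => i; exact: mulgV.
Qed.

HB.instance Definition _ :=
  isGroup.Build (family D) familyA family1m familym1 familyVm familymV.

End Family.

Hypothesis dirI : directed_set I.

Definition germ_subgroup (D : I -> groupType) : subgroup (family D).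
Proof.
exists (fun x : family D => exists j, forall k, (j <= k)%O -> x k = 1).
- by case: dirI => -[i] _; exists i.
- move=> x y [i xi] [j yj]; have [k [ik jk]] := dirI.2 i j.
  exists k => l kl; transitivity (x l * y l); first by [].
  by rewrite xi ?yj ?mulg1 //; exact: le_trans kl.
- move=> x [i xi]; exists i => k ik; transitivity (x k)^-1; first by [].
  by rewrite xi ?invg1.
Defined.

Definition germ_normal (D : I -> groupType) : normal_subgroup (family D).
Proof.
exists (germ_subgroup D) => x y [i xi]; exists i => k ik.
transitivity ((y k)^-1 * (x k * y k)); first by [].
by rewrite xi // mul1g mulVg.
Defined.

Variable D : direct_system I.

(** The value 1 at indices not above [i] is harmless, since germs see only large indices. *)
Definition thread (i : I) (x : D i) : family D := fun j =>
  if pselect (i <= j)%O is left ij then ds_map D ij x else 1.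

Lemma threadE i j (x : D i) (ij : (i <= j)%O) : thread x j = ds_map D ij x.
Proof.
rewrite /thread; case: pselect => [ij'|//].
by rewrite (bool_irrelevance ij ij').
Qed.

Fact threadM i : {morph @thread i : x y / x * y}.
Proof.
move=> x y; apply: functional_extensionality_dep => j.
transitivity (thread x j * thread y j); last by [].
by rewrite /thread; case: pselect => [ij|_]; rewrite ?gmulfM ?mulg1.
Qed.

Definition germ (i : I) : {hom D i -> quogrp (germ_normal D)} :=
  quo_pi (germ_normal D) \o hom_of (@threadM i).

Lemma germ_cocone : cocone germ.
Proof.
move=> i j ij x; apply/quo_pi_eq; exists j => k jk.
have ik := le_trans ij jk.
transitivity ((thread (ds_map D ij x) k)^-1 * thread x k); first by [].
by rewrite !threadE (ds_map_comp ij jk ik) mulVg.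
Qed.

Lemma germ_eq1 i (x : D i) : germ i x = 1 ->
  exists j (ij : (i <= j)%O), ds_map D ij x = 1.
Proof.
move=> /quo_pi_eq1[j jx]; have [k [ik jk]] := dirI.2 i j.
by exists k, ik; rewrite -threadE; exact: jx.
Qed.

End ReducedProduct.

(** * Elementwise criteria for direct limits *)

Section Filtered.
Variables (d : Order.disp_t) (I : preorderType d) (dirI : directed_set I).

Definition exhaustive (D : direct_system I) (L : groupType)
  (c : forall i, {hom D i -> L}) := forall x, exists i y, c i y = x.

Definition separated (D : direct_system I) (L : groupType)
    (c : forall i, {hom D i -> L}) := forall i (x : D i), c i x = 1 ->
  exists j (ij : (i <= j)%O), ds_map D ij x = 1.

Section Limit.
Variables (D : direct_system I) (L : groupType) (c : forall i, {hom D i -> L}).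

(** The cocone of germs factors through [L], so an element that dies in [L] has a trivial germ. *)
Lemma limit_separated : is_direct_limit c -> separated c.
Proof.
move=> [_ univ] i x cx; have [u [uc _]] := univ _ _ (germ_cocone dirI (D := D)).
by apply: (@germ_eq1 _ _ dirI D); rewrite -(uc i) /= cx gmulf1.
Qed.

Hypothesis cc : cocone c.

Lemma cocone_push i j k (ij : (i <= j)%O) (jk : (j <= k)%O) (ik : (i <= k)%O)
  (x : D i) : ds_map D ik x = ds_map D jk (ds_map D ij x).
Proof. exact: ds_map_comp. Qed.

Definition image_subgroup : subgroup L.
Proof.
exists (fun x => exists i y, c i y = x).
- by case: dirI => -[i] _; exists i, 1; rewrite gmulf1.
- move=> _ _ [i [x <-]] [j [y <-]]; have [k [ik jk]] := dirI.2 i j.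
  exists k, (ds_map D ik x * ds_map D jk y).
  by rewrite gmulfM; have /= -> := cc ik x; have /= -> := cc jk y.
- by move=> _ [i [x <-]]; exists i, x^-1; rewrite gmulfV.
Defined.

(** The cocone lands in the union of the images, so [L] maps to this subgroup; by uniqueness, that
    map followed by the inclusion is the identity. *)
Lemma limit_exhaustive : is_direct_limit c -> exhaustive c.
Proof.
move=> [_ univ] x.
have cP i y : image_subgroup (c i y) by exists i, y.
have cM i : {morph (fun y => to_subgrp (cP i y)) : y z / y * z}.
  by move=> y z; apply: val_inj; exact: gmulfM.
have valM : {morph (val : subgrp image_subgroup -> L) : a b / a * b} by [].
have [|u [uc _]] := univ _ (fun i => hom_of (cM i)).
  by move=> i j ij y; apply: val_inj; exact: cc.
have [v [_ uniq_v]] := univ _ _ cc.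
have e1 := uniq_v (@idfun L) (fun _ _ => erefl).
have e2 := uniq_v (hom_of valM \o u) (fun i y => congr1 val (uc i y)).
suff <- : val (u x) = x by exact: (subgrpP (u x)).
by have := congr1 (fun h : {hom L -> L} => h x) (etrans (esym e2) e1).
Qed.

Lemma exhaustive_seq i (s : seq L) : exhaustive c ->
  exists2 j, (i <= j)%O & {in s, forall x, exists y, c j y = x}.
Proof.
move=> exc; elim: s => [|x s [j ij js]]; first by exists i.
have [j' [y cy]] := exc x; have [k [jk jk']] := dirI.2 j j'.
exists k; first exact: le_trans jk.
move=> z; rewrite inE => /orP[/eqP->|/js[y' <-]].
  by exists (ds_map D jk' y); rewrite -cy; exact: cc.
by exists (ds_map D jk y'); exact: cc.
Qed.

Lemma separated_seq i (s : seq (D i * D i)) : separated c ->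
  {in s, forall p, c i p.1 = c i p.2} ->
  exists j (ij : (i <= j)%O),
    {in s, forall p, ds_map D ij p.1 = ds_map D ij p.2}.
Proof.
move=> sepc; elim: s => [_|[x y] s IH cs]; first by exists i, (lexx i).
have [|j [ij js]] := IH; first by move=> p ps; apply: cs; rewrite inE ps orbT.
have [|j' [ij' jx]] := sepc i (x^-1 * y).
  by rewrite gmulfM gmulfV (cs (x, y)) ?mulVg // inE eqxx.
have [k [jk jk']] := dirI.2 j j'; have ik := le_trans ij jk.
exists k, ik => p; rewrite inE => /orP[/eqP->|/js ps] /=.
  apply: (mulgI (ds_map D ik x)^-1); rewrite mulVg -gmulfV -gmulfM.
  by rewrite (cocone_push ij' jk') jx gmulf1.
by rewrite !(cocone_push ij jk) ps.
Qed.

End Limit.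

End Filtered.
(** * The Baer invariant of a direct limit *)

Section PairLimit.
Variables (V : set word) (R : free_resolution).
Variables (d : Order.disp_t) (I : preorderType d) (dirI : directed_set I).
Variables (D : pair_system I) (P : group_pair) (c : forall i, pair_hom (D i) P).
Hypothesis limP : is_direct_limit_pair c.

Lemma pair_quo_mapE (Q Q' : group_pair) (f : pair_hom Q Q') x :
  pair_quo_map f (quo_pi (gp_sub Q) x) = quo_pi (gp_sub Q') (f x).
Proof. exact: quo_mapE. Qed.

Definition quo_system : direct_system I.
Proof.
exists (fun i => pair_quo (D i)) (fun i j ij => pair_quo_map (ps_map D ij)).
- by move=> i ii; apply: quo_piP => x; rewrite pair_quo_mapE ps_map_id.
- move=> i j k ij jk ik; apply: quo_piP => x.
  by rewrite /comp !pair_quo_mapE (ps_map_comp ij jk ik).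
Defined.

Let cgrp : cocone (D := grp_system D) c := proj1 (proj1 limP).
Let csub := proj1 (proj2 limP).

Lemma pair_cocone i j (ij : (i <= j)%O) x : c j (ps_map D ij x) = c i x.
Proof. exact: cgrp. Qed.

Lemma quo_cocone : cocone (D := quo_system) (fun i => pair_quo_map (c i)).
Proof.
move=> i j ij; apply: quo_piP => x.
by rewrite /comp [ds_map _ _ _]pair_quo_mapE !pair_quo_mapE pair_cocone.
Qed.

Lemma grp_exhaustive : exhaustive (D := grp_system D) c.
Proof. exact: limit_exhaustive cgrp (proj1 limP). Qed.

Lemma grp_separated : separated (D := grp_system D) c.
Proof. exact: limit_separated (proj1 limP). Qed.

Lemma quo_exhaustive :
  exhaustive (D := quo_system) (fun i => pair_quo_map (c i)).
Proof.
apply: quo_piP => x; have [i [y <-]] := grp_exhaustive x.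
by exists i, (quo_pi _ y); exact: pair_quo_mapE.
Qed.

(** This rests on N being the limit of the N_i: if [c i x] is in N, it comes from some [n] in an
    N_i', and [x] and [n] become equal at a later index. *)
Lemma quo_separated :
  separated (D := quo_system) (fun i => pair_quo_map (c i)).
Proof.
move=> i; apply: quo_piP => x; rewrite pair_quo_mapE => /quo_pi_eq1 Nx.
have [i' [n nx]] := limit_exhaustive dirI csub (proj2 limP) (to_subgrp Nx).
have {}nx : c i' (val n) = c i x := congr1 val nx.
have [j [ij ij']] := dirI.2 i i'.
have [|k [jk]] := @grp_separated j ((ps_map D ij x)^-1 * ps_map D ij' (val n)).
  by rewrite gmulfM gmulfV !pair_cocone nx mulVg.
rewrite /= gmulfM gmulfV => /(canRL (mulVKg _)); rewrite mulg1 => e.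
have ik := le_trans ij jk; exists k, ik.
rewrite [LHS]pair_quo_mapE; apply/quo_pi_eq1.
rewrite (ps_map_comp ij jk ik) /= -e.
by do 2!apply: ph_sub; exact: subgrpP.
Qed.

Lemma pair_separated_seq i (s : seq (D i * D i))
    (s' : seq (pair_quo (D i) * pair_quo (D i))) :
  {in s, forall p, c i p.1 = c i p.2} ->
  {in s', forall p, pair_quo_map (c i) p.1 = pair_quo_map (c i) p.2} ->
  exists j (ij : (i <= j)%O),
    {in s, forall p, ps_map D ij p.1 = ps_map D ij p.2} /\
    {in s', forall p, pair_quo_map (ps_map D ij) p.1 =
                      pair_quo_map (ps_map D ij) p.2}.
Proof.
move=> /(separated_seq dirI grp_separated)[j [ij js]].
move=> /(separated_seq dirI quo_separated)[j' [ij' js']].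
have [k [jk jk']] := dirI.2 j j'; have ik := le_trans ij jk; exists k, ik.
split=> p ps.
  rewrite !(ps_map_comp ij jk ik); congr (ps_map D jk _); exact: js.
have qE := @ds_map_comp _ _ quo_system _ _ _ ij' jk' ik.
apply: etrans (qE p.1) _; apply: etrans _ (esym (qE p.2)).
congr (pair_quo_map (ps_map D jk') _); exact: js'.
Qed.

(** A replacement for a map from the resolutions of the limit back to stage [j], on vertices only
    and tested only on two lists. *)
Definition partial_section (Zf : seq (R P 0)) (Zh : seq (R (pair_quo P) 0)) j
    (phi : {hom R P 0 -> R (D j) 0})
    (psi : {hom R (pair_quo P) 0 -> R (pair_quo (D j)) 0}) : Prop :=
  {in Zf, forall f, baer_alpha R (D j) 0 (phi f) = psi (baer_alpha R P 0 f) /\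
     c j (aug R _ (phi f)) = aug R P f} /\
  {in Zh, forall h, pair_quo_map (c j) (aug R _ (psi h)) = aug R _ h}.

(** Augmentations that agree only in the limit become equal after such a push. *)
Lemma partial_section_push Zf Zh j k (jk : (j <= k)%O) phi psi :
  partial_section Zf Zh (j := j) phi psi ->
  exists phi' psi', [/\ partial_section Zf Zh (j := k) phi' psi',
    forall x, aug R _ (phi' x) = ps_map D jk (aug R _ (phi x)) &
    forall x, aug R _ (psi' x) = pair_quo_map (ps_map D jk) (aug R _ (psi x))].
Proof.
move=> [phiP psiP]; exists (fr_map R (ps_map D jk) 0 \o phi).
exists (fr_map R (pair_quo_map (ps_map D jk)) 0 \o psi).
split=> [|x|x]; [|exact: aug_nat..]; split=> [f /phiP[af cf]|h /psiP ch].
  by rewrite /= alpha_nat af aug_nat pair_cocone.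
by rewrite /= aug_nat -ch; exact: quo_cocone.
Qed.

Lemma partial_section_ex Zf Zh i : exists j (_ : (i <= j)%O) phi psi,
  partial_section Zf Zh (j := j) phi psi.
Proof.
have [X freeX] := resolution_basis R P 0.
have [Y freeY] := resolution_basis R (pair_quo P) 0.
have [Z ZX Zs] := free_support_seq Zf freeX.
have [Z' ZY Zs'] :=
  free_support_seq (Zh ++ [seq baer_alpha R P 0 z | z <- Z]) freeY.
(* At [j0] the generators in [Z'] have augmentations to be lifted, which gives [psi0]. *)
have [j0 ij0 j0P] := exhaustive_seq dirI quo_cocone i
  [seq aug R _ y | y <- Z'] quo_exhaustive.
have [|psi0 psi0P] := @free_extend _ (R (pair_quo (D j0)) 0) _ Z'
    (fun y h => pair_quo_map (c j0) (aug R _ h) = aug R _ y) freeY ZY.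
  move=> y /(map_f (aug R _))/j0P[v <-]; have [h <-] := aug_surj R v.
  by exists h.
have psi0E h : supported Z' h ->
    pair_quo_map (c j0) (aug R _ (psi0 h)) = aug R _ h.
  by move=> /(_ _ (pair_quo_map (c j0) \o (aug R _ \o psi0)) (aug R _)); apply.
(* At [j1] the augmentations of the generators in [Z] have preimages [g z]. *)
have [j1 j01 j1P] := exhaustive_seq dirI cgrp j0
  [seq aug R P z | z <- Z] grp_exhaustive.
have [|g gP] := @choice_seq _ _ (1 : D j1) Z
    (fun z y => c j1 y = aug R P z).
  by move=> z Zz; apply: j1P; exact: map_f.
pose psi1 := fr_map R (pair_quo_map (ps_map D j01)) 0 \o psi0.
have psi1E h : supported Z' h ->
    pair_quo_map (c j1) (aug R _ (psi1 h)) = aug R _ h.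
  by move=> /psi0E <-; rewrite /psi1 /comp aug_nat; exact: quo_cocone.
have aZ z : z \in Z -> supported Z' (baer_alpha R P 0 z).
  by move=> Zz; apply: Zs'; rewrite mem_cat map_f ?orbT.
(* At [j2] the class of [g z] equals the augmentation of the partner of [z] under [psi], as
   [vertex_lift] requires. *)
have [||j2 [j12 [_ j2P]]] := @pair_separated_seq j1 [::]
    [seq (aug R _ (psi1 (baer_alpha R P 0 z)), quo_pi _ (g z)) | z <- Z].
- by [].
- move=> _ /mapP[z Zz ->]; apply: etrans (psi1E _ (aZ _ Zz)) _.
  by rewrite aug_alpha -(gP z Zz); symmetry; exact: pair_quo_mapE.
pose psi := fr_map R (pair_quo_map (ps_map D j12)) 0 \o psi1.
have psiE h : supported Z' h ->
    pair_quo_map (c j2) (aug R _ (psi h)) = aug R _ h.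
  by move=> /psi1E <-; rewrite /psi /comp aug_nat; exact: quo_cocone.
have [|phi phiP] := @free_extend _ (R (D j2) 0) _ Z
    (fun z f => baer_alpha R (D j2) 0 f = psi (baer_alpha R P 0 z) /\
       aug R _ f = ps_map D j12 (g z)) freeX ZX.
  move=> z Zz; apply: vertex_lift; rewrite /psi [LHS]aug_nat.
  have := j2P _ (map_f _ Zz); rewrite pair_quo_mapE; exact.
exists j2, (le_trans ij0 (le_trans j01 j12)), phi, psi.
split=> [f /Zs fZ|h hZ]; last by apply/psiE/Zs'; rewrite mem_cat hZ.
split.
  by apply: (fZ _ (baer_alpha R (D j2) 0 \o phi) (psi \o baer_alpha R P 0)) =>
    z /phiP[].
apply: (fZ _ (c j2 \o (aug R _ \o phi)) (aug R P)) => z Zz.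
by apply: etrans (congr1 (c j2) (phiP z Zz).2) _; rewrite pair_cocone gP.
Qed.

(** A relator [w] for [xi] is carried back by [phi] to a relator of a finite stage; the element it
    classifies maps to [xi], because [phi] followed by [c k] is homotopic to the identity. *)
Lemma baer_exhaustive :
  exhaustive (D := baer_system D V R) (fun i => baer_map V R (c i)).
Proof.
move=> xi; have [w rw wxi] := classifies_relator xi.
have [Vw aw w1] := rw.
have [X freeX] := resolution_basis R P 0.
have [Y freeY] := resolution_basis R (pair_quo P) 0.
have [Z [Z' homotopyP]] := finite_homotopy R (baer_alpha R P 0) w freeX freeY.
case: dirI => -[i] _.
have [j [_ [phi0 [psi0 ps0]]]] := partial_section_ex (w :: Z) Z' i.
(* The augmentation of [phi0 w] is trivial only in the limit; it becomes trivial at [k]. *)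
have [|k [jk kw]] := @grp_separated j (aug R _ (phi0 w)).
  by rewrite (ps0.1 w _).2 ?inE ?eqxx.
have [phi [psi [[phiP psiP] augphi _]]] := partial_section_push jk ps0.
have [|eta weta] := @relator_classifies V R (D k) (phi w).
  split; first exact: verbal_hom.
    by rewrite (phiP w _).1 ?inE ?eqxx // aw gmulf1.
  by rewrite augphi; exact: kw.
exists k, eta; have cweta := classifies_map (c k) weta.
apply: classifies_eq cweta wxi _.
have [||||t [Vt t0 t1 at1]] := homotopyP V P (fr_map R (c k) 0 \o phi) idfun
    (fr_map R (pair_quo_map (c k)) 0 \o psi) idfun.
- move=> z Zz; have [|az cz] := phiP z; first by rewrite inE Zz orbT.
  by split; rewrite /= ?alpha_nat ?az // aug_nat cz.
- by move=> z /psiP cz; rewrite /= aug_nat cz.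
- by [].
- by [].
by have := null_homotopy Vt at1; rewrite t0 t1.
Qed.

(** Two homotopies are combined: one shows that [phi] sends the image of [w] to a null vertex, the
    other compares that vertex with the image of [w] under the transition map. *)
Lemma baer_separated :
  separated (D := baer_system D V R) (fun i => baer_map V R (c i)).
Proof.
move=> i xi cxi; have [w [Vw aw _] wxi] := classifies_relator xi.
have := classifies_map (c i) wxi; rewrite cxi => /null_classifies.
move=> [t [Vt t0 t1 at1]].
have [X freeX] := resolution_basis R P 1%N.
have [Y freeY] := resolution_basis R (pair_quo P) 1%N.
have [Z1 [Z1' homotopy1]] :=
  finite_homotopy R (baer_alpha R P 1%N) t freeX freeY.
have [Xi freeXi] := resolution_basis R (D i) 0.
have [Yi freeYi] := resolution_basis R (pair_quo (D i)) 0.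
have [Z2 [Z2' homotopy2]] :=
  finite_homotopy R (baer_alpha R (D i) 0) w freeXi freeYi.
(* [Zf] and [Zh] collect the vertices at which both homotopies will evaluate [phi] and [psi]. *)
pose Zf := [seq face ord0 z | z <- Z1] ++ [seq face ord_max z | z <- Z1] ++
  [seq fr_map R (c i) 0 z | z <- Z2].
pose Zh := [seq face ord0 z | z <- Z1'] ++ [seq face ord_max z | z <- Z1'] ++
  [seq fr_map R (pair_quo_map (c i)) 0 z | z <- Z2'].
have [j [ij [phi0 [psi0 ps0]]]] := partial_section_ex Zf Zh i.
have Zf0 z : z \in Z1 -> face ord0 z \in Zf.
  by move=> Zz; rewrite mem_cat map_f.
have Zf1 z : z \in Z1 -> face ord_max z \in Zf.
  by move=> Zz; rewrite !mem_cat map_f ?orbT.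
have Zf2 z : z \in Z2 -> fr_map R (c i) 0 z \in Zf.
  by move=> Zz; rewrite !mem_cat (map_f (fr_map R (c i) 0)) ?orbT.
have Zh0 z : z \in Z1' -> face ord0 z \in Zh.
  by move=> Zz; rewrite mem_cat map_f.
have Zh1 z : z \in Z1' -> face ord_max z \in Zh.
  by move=> Zz; rewrite !mem_cat map_f ?orbT.
have Zh2 z : z \in Z2' -> fr_map R (pair_quo_map (c i)) 0 z \in Zh.
  move=> Zz; rewrite !mem_cat.
  by rewrite (map_f (fr_map R (pair_quo_map (c i)) 0)) ?orbT.
have aug_face (G : groupType) (z : R G 1%N) :
    aug R G (face ord0 z) = aug R G (face ord_max z).
  by apply/aug_eq; exists z.
(* The augmentations to be compared agree in the limit, hence at some [k]. *)
have [||k [jk [kf kh]]] := @pair_separated_seq j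
  ([seq (aug R _ (phi0 (face ord0 z)), aug R _ (phi0 (face ord_max z)))
     | z <- Z1] ++
   [seq (aug R _ (phi0 (fr_map R (c i) 0 z)), ps_map D ij (aug R _ z))
     | z <- Z2])
  ([seq (aug R _ (psi0 (face ord0 z)), aug R _ (psi0 (face ord_max z)))
     | z <- Z1'] ++
   [seq (aug R _ (psi0 (fr_map R (pair_quo_map (c i)) 0 z)),
         pair_quo_map (ps_map D ij) (aug R _ z)) | z <- Z2']).
- move=> p; rewrite mem_cat => /orP[]/mapP[z Zz ->] /=.
    by rewrite (ps0.1 _ (Zf0 _ Zz)).2 (ps0.1 _ (Zf1 _ Zz)).2 aug_face.
  by rewrite (ps0.1 _ (Zf2 _ Zz)).2 aug_nat pair_cocone.
- move=> p; rewrite mem_cat => /orP[]/mapP[z Zz ->].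
    apply: etrans (ps0.2 _ (Zh0 _ Zz)) _; rewrite aug_face.
    exact: esym (ps0.2 _ (Zh1 _ Zz)).
  apply: etrans (ps0.2 _ (Zh2 _ Zz)) _; rewrite aug_nat; symmetry.
  exact: quo_cocone.
have ik := le_trans ij jk; exists k, ik.
have [phi [psi [[phiP psiP] augphi augpsi]]] := partial_section_push jk ps0.
(* As [phi] is defined on vertices only, the edge [t] is replaced by the value at [t] of a homotopy
   from [phi \o face ord0] to [phi \o face ord_max]. *)
have [||||u1 [Vu1 u10 u11 au1]] := homotopy1 V (D k) (phi \o face ord0)
    (phi \o face ord_max) (psi \o face ord0) (psi \o face ord_max).
- move=> z Zz; rewrite /= (phiP _ (Zf0 _ Zz)).1 (phiP _ (Zf1 _ Zz)).1.
  rewrite !sh_face !augphi; split=> //.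
  by apply: (kf (_, _)); rewrite mem_cat (map_f (fun z => (_, _))).
- move=> z Zz; rewrite /= !augpsi.
  by apply: (kh (_, _)); rewrite mem_cat (map_f (fun z => (_, _))).
- by [].
- by [].
(* Going through the limit and back by [phi] is homotopic to the transition map from [i] to [k]. *)
have [||||u2 [Vu2 u20 u21 au2]] := homotopy2 V (D k) (phi \o fr_map R (c i) 0)
    (fr_map R (ps_map D ik) 0) (psi \o fr_map R (pair_quo_map (c i)) 0)
    (fr_map R (pair_quo_map (ps_map D ik)) 0).
- move=> z Zz; rewrite /= (phiP _ (Zf2 _ Zz)).1 !alpha_nat; split=> //.
  rewrite augphi aug_nat (ps_map_comp ij jk ik).
  by apply: (kf (_, _)); rewrite mem_cat (map_f (fun z => (_, _))) ?orbT.
- move=> z Zz; rewrite /= augpsi aug_nat.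
  apply: etrans (esym (@ds_map_comp _ _ quo_system _ _ _ ij jk ik _)).
  by apply: (kh (_, _)); rewrite mem_cat (map_f (fun z => (_, _))) ?orbT.
- by [].
- by [].
apply: classifies_null (classifies_map (ps_map D ik) wxi) _.
have n1 : null V (phi (fr_map R (c i) 0 w)).
  by exists u1; rewrite u10 u11 /= t0 t1 !gmulf1.
have := nullM n1 (null_homotopy Vu2 au2).
by rewrite u20 u21 mulVKg.
Qed.

End PairLimit.

(** * Comparison of the limit of the Baer invariants with that of the limit pair *)

Theorem theorem3p7
  (V : set word) (R : free_resolution)
  (d : Order.disp_t) (I : preorderType d) (dirI : directed_set I)
  (D : pair_system I)
  (P : group_pair) (c : forall i : I, pair_hom (D i) P)
  (limP : is_direct_limit_pair c)
  (L : groupType) (l : forall i : I, {hom baer V R (D i) -> L})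
  (limL : is_direct_limit (D := baer_system D V R) l) :
  isomorphic (baer V R P) L.
Proof.
have cb : cocone (D := baer_system D V R) (fun i => baer_map V R (c i)).
  move=> i j ij x; symmetry; apply: baer_map_comp => y /=.
  by rewrite (pair_cocone limP).
have [u [ul _]] := limL.2 _ _ cb.
have lexc := limit_exhaustive dirI limL.1 limL.
have usurj y : exists x, u x = y.
  have [i [x <-]] := baer_exhaustive dirI limP y.
  by exists (l i x); exact: ul.
have ker_u x : u x = 1 -> x = 1.
  have [i [y <-]] := lexc x => uy.
  have [|j [ij jy]] := @baer_separated V R _ _ dirI _ _ _ limP i y.
    by rewrite -(ul i).
  rewrite -(limL.1 i j ij); apply: etrans (congr1 (l j) jy) _; exact: gmulf1.
have uinj x y : u x = u y -> x = y.
  move=> xy; apply: (mulgI y^-1); rewrite mulVg; apply: ker_u.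
  by rewrite gmulfM gmulfV xy mulVg.
(* The comparison map [u] starts at [L]; the isomorphism sought is its inverse. *)
have [v vK] := choice usurj.
have vM : {morph v : x y / x * y}.
  by move=> x y; apply: uinj; rewrite gmulfM !vK.
exists (hom_of vM); exists u => [|x]; first exact: vK.
by apply: uinj; exact: vK.
Qed.
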